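(* Let $h>0$, let $A_h=\frac{1}{h^2}\begin{bmatrix}&-1&\\-1&4&-1\\&-1&\end{bmatrix}$ be the five-point discrete Laplacian on the infinite two-dimensional grid $h\mathbb{Z}^2$, let $M_e$ be the element-wise additive Vanka operator for $A_h$, and let $S_e=I-\omega M_eA_h$, $\omega\in\mathbb{R}$. Let $\widetilde{A}_h(\boldsymbol\theta)$ and $\widetilde{M}_e(\boldsymbol\theta)$, $\boldsymbol\theta=(\theta_1,\theta_2)$, denote the symbols of $A_h$ and $M_e$, and let $T^{\rm high}=[-\frac{\pi}{2},\frac{3\pi}{2})^2\setminus[-\frac{\pi}{2},\frac{\pi}{2})^2$. Then the optimal smoothing factor of $S_e$ is $$\mu_{e,\rm opt}=\min_{\omega\in\mathbb{R}}\ \max_{\boldsymbol\theta\in T^{\rm high}}\left|1-\omega\,\widetilde{M}_e(\boldsymbol\theta)\widetilde{A}_h(\boldsymbol\theta)\right|=\frac{7}{25},$$ and the minimum over $\omega$ is uniquely achieved at $\omega=\frac{24}{25}$.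
   Context: Grid functions are functions $u:h\mathbb{Z}^2\to\mathbb{C}$. A stencil $[s_{\boldsymbol k}]_{\boldsymbol k\in\mathbb{Z}^2}$ (finitely many nonzero entries, the centre entry being $\boldsymbol k=0$) defines the operator $(Su)(\boldsymbol x)=\sum_{\boldsymbol k} s_{\boldsymbol k}\,u(\boldsymbol x+h\boldsymbol k)$. The symbol of such an operator $S$ is the function $\widetilde{S}(\boldsymbol\theta)$ with $S e^{\iota\boldsymbol\theta\cdot\boldsymbol x/h}=\widetilde{S}(\boldsymbol\theta)e^{\iota\boldsymbol\theta\cdot\boldsymbol x/h}$, where $\iota^2=-1$. Additive Vanka operator: given a family of finite subsets (patches) $\Upsilon_i$ of the grid whose union is the whole grid, let $V_i$ be the restriction of a grid function to $\Upsilon_i$, $V_i^T$ its transpose (extension by zero), and $A_i=V_iA_hV_i^T$. Then $M=\sum_i V_i^T W_i A_i^{-1}V_i$, where $W_i$ is the diagonal matrix whose entry at each grid point of $\Upsilon_i$ is the reciprocal of the number of patches containing that grid point. The element-wise Vanka operator $M_e$ in two dimensions uses as patches the sets of four corners of each grid cell, $\{\boldsymbol x,\ \boldsymbol x+(h,0),\ \boldsymbol x+(0,h),\ \boldsymbol x+(h,h)\}$, $\boldsymbol x\in h\mathbb{Z}^2$ (so, in this ordering, $A_i=\frac{1}{h^2}\begin{pmatrix}4&-1&-1&0\\-1&4&0&-1\\-1&0&4&-1\\0&-1&-1&4\end{pmatrix}$ and $W_i=\frac14 I$). *)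

(* Defs.v *)
From HB Require Import structures.
From mathcomp Require Import all_boot all_order all_algebra.
From mathcomp Require Import finmap.
From mathcomp Require Import complex.
From mathcomp Require Import all_classical all_reals all_analysis.

Set Implicit Arguments.
Unset Strict Implicit.
Unset Printing Implicit Defensive.

Import Order.TTheory GRing.Theory Num.Theory.

Local Open Scope classical_set_scope.
Local Open Scope ring_scope.
Local Open Scope complex_scope.

(* The grid h Z^2 is indexed by Z^2: the index k stands for the point h k,
   so that translating a point by h j is adding j to its index. *)
Definition gridfun (R : realType) : Type := int * int -> R[i].

Definition gridpoint (R : realType) (h : R) (k : int * int) : R * R :=
  (h * k.1%:~R, h * k.2%:~R).

(* The grid function x |-> exp (i theta . x / h). *)
Definition fourier_mode (R : realType) (h : R) (theta : R * R) : gridfun R :=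
  fun k => let x := gridpoint h k in
           let t := (theta.1 * x.1 + theta.2 * x.2) / h in
           cos t +i* sin t.

Definition is_symbol_at (R : realType) (h : R) (S : gridfun R -> gridfun R)
    (theta : R * R) (z : R[i]) : Prop :=
  forall k : int * int,
    S (fourier_mode h theta) k = z * fourier_mode h theta k.

(* Fourier modes do not vanish, so there is at most one such value; an
   operator which does not act on the mode as a scalar gets the junk value 0. *)
Definition symbol (R : realType) (h : R) (S : gridfun R -> gridfun R)
    (theta : R * R) : R[i] :=
  xget 0 [set z | is_symbol_at h S theta z].

Definition stencil_op (R : realType) (s : {fsfun int * int -> R[i] with 0})
    (u : gridfun R) : gridfun R :=
  fun x => \sum_(k <- finsupp s) s k * u (x + k).

Definition laplace_stencil (R : realType) (h : R) :
    {fsfun int * int -> R[i] with 0} :=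
  [fsfun k in [fset 0; (1, 0); (-1, 0); (0, 1); (0, -1)]%fset : {fset int * int}
     => (if k == 0 then 4 / h ^+ 2 else - 1 / h ^+ 2)%:C | 0].

Definition laplace (R : realType) (h : R) : gridfun R -> gridfun R :=
  stencil_op (laplace_stencil h).

(* Grid functions on a patch P are column vectors, their entries being ordered
   by the enumeration of P. *)
Definition patch_restrict (R : realType) (P : {fset int * int}) (u : gridfun R) :
    'cV[R[i]]_#|{: P}| :=
  \col_j u (fsval (enum_val j)).

Definition patch_extend (R : realType) (P : {fset int * int})
    (v : 'cV[R[i]]_#|{: P}|) : gridfun R :=
  fun x => \sum_(j < #|{: P}| | fsval (enum_val j) == x) v j 0.

(* The matrix of V A V^T, column by column. *)
Definition patch_matrix (R : realType) (A : gridfun R -> gridfun R)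
    (P : {fset int * int}) : 'M[R[i]]_#|{: P}| :=
  \matrix_(j, k) patch_restrict P (A (patch_extend (delta_mx k 0))) j 0.

Definition patch_weight (R : realType) (I : choiceType)
    (patch : I -> {fset int * int}) (i : I) : 'M[R[i]]_#|{: patch i}| :=
  diag_mx (\row_j (#|` fset_set [set i' | fsval (enum_val j) \in patch i']|
                     %:R)^-1).

(* The family of patches may be infinite; the sum is meaningful when each grid
   point lies in finitely many of them. *)
Definition vanka (R : realType) (I : choiceType)
    (patch : I -> {fset int * int}) (A : gridfun R -> gridfun R)
    (u : gridfun R) : gridfun R :=
  fun x => \sum_(i \in [set: I])
    patch_extend (patch_weight R patch i *m invmx (patch_matrix A (patch i))
              *m patch_restrict (patch i) u) x.

Definition element_patch (x : int * int) : {fset int * int} :=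
  [fset x; (x + (1, 0))%R; (x + (0, 1))%R; (x + (1, 1))%R]%fset.

Definition element_vanka (R : realType) (h : R) : gridfun R -> gridfun R :=
  vanka element_patch (laplace h).

Definition element_relax (R : realType) (h omega : R) (u : gridfun R) :
    gridfun R :=
  fun x => u x - omega%:C * element_vanka h (laplace h u) x.

Definition Thigh (R : realType) : set (R * R) :=
  (`[- (pi / 2), 3 * pi / 2[ `*` `[- (pi / 2), 3 * pi / 2[)
  `\` (`[- (pi / 2), pi / 2[ `*` `[- (pi / 2), pi / 2[).

Arguments Thigh : clear implicits.

Definition is_maximum (R : realType) (E : set R) (m : R) : Prop :=
  E m /\ ubound E m.

Definition is_minimum (R : realType) (E : set R) (m : R) : Prop :=
  E m /\ lbound E m.

(* m is the smoothing factor of the relaxation operator S. *)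
Definition is_smoothing_factor (R : realType) (h : R)
    (S : gridfun R -> gridfun R) (m : R) : Prop :=
  is_maximum [set Normc.normc (symbol h S theta) | theta in Thigh R] m.

(* Main.v *)
(* Inverting the 4 x 4 patch matrix turns M_e into a 9-point stencil, and with
   c_j = cos theta_j the product of the two symbols is
     f = (2 - c_1 - c_2) (7 + 2 (c_1 + c_2) + c_1 c_2) / 12.
   On T^high one of c_1, c_2 is nonpositive, and f ranges within [3/4, 4/3], both
   ends being attained (at (c_1, c_2) = (1, 0) and (-1, -1)).  As 1 - omega f is
   affine in f, the smoothing factor is max(|1 - 3 omega / 4|, |1 - 4 omega / 3|),
   which is minimal exactly where the two terms balance, at omega = 24/25. *)
Require Import Defs.
From HB Require Import structures.
From mathcomp Require Import all_boot all_order all_algebra.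
From mathcomp Require Import finmap.
From mathcomp Require Import complex.
From mathcomp Require Import all_classical all_reals all_analysis.
From mathcomp Require Import ring lra.

Import Order.TTheory GRing.Theory Num.Theory.

Local Open Scope classical_set_scope.
Local Open Scope ring_scope.
Local Open Scope complex_scope.

(** * Restriction to a finite patch *)

Lemma sum_patch_enum (V : nmodType) (P : {fset int * int}) (F : int * int -> V) :
  \sum_(j < #|{: P}|) F (fsval (enum_val j)) = \sum_(p <- P) F p.
Proof. by rewrite big_seq_fsetE -(big_enum_val (A := P) (fun p => F (fsval p))). Qed.

Lemma patch_extend_fun (R : realType) (P : {fset int * int})
    (F : gridfun R) (x : int * int) :
  patch_extend (\col_(j < #|{: P}|) F (fsval (enum_val j))) x =
  if x \in P then F x else 0.
Proof.
rewrite /patch_extend big_mkcond /=.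
under eq_bigr => j _ do rewrite mxE.
rewrite (sum_patch_enum _ P (fun p => if p == x then F p else 0)).
rewrite -big_mkcond /=; case: ifPn => xP.
  by rewrite -big_filter filter_pred1_uniq ?fset_uniq // big_seq1.
rewrite big_seq_cond big1 // => p /andP[pP /eqP px].
by rewrite -px pP in xP.
Qed.

(** Supplies the entries of the patch matrices: only the stencil entry at the offset from [x] to the
    supporting point of the delta survives. *)
Lemma stencil_op_delta (R : realType) (s : {fsfun int * int -> R[i] with 0})
    (P : {fset int * int}) (k : 'I_#|{: P}|) (x : int * int) :
  stencil_op s (patch_extend (delta_mx k 0)) x = s (fsval (enum_val k) - x).
Proof.
have -> : patch_extend (delta_mx k 0) =
    fun y => (y == fsval (enum_val k))%:R :> R[i].
  apply/funext => y; rewrite /patch_extend.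
  have [->|yk] := eqVneq.
    rewrite (bigD1 k) //= mxE !eqxx big1 ?addr0 // => j /andP[_ /negPf jk].
    by rewrite mxE jk.
  rewrite big1 // => j /eqP jy; rewrite mxE; case: eqP => // jk.
  by rewrite -jy jk eqxx in yk.
rewrite /stencil_op; set p := fsval _.
have e k' : (x + k' == p) = (k' == p - x).
  by rewrite addrC -subr_eq opprK eq_sym -subr_eq eq_sym.
under eq_bigr => k' _ do rewrite e mulr_natr mulrb.
rewrite -big_mkcond /=.
have [px|px] := boolP (p - x \in finsupp s).
  by rewrite -big_filter filter_pred1_uniq ?fset_uniq // big_seq1.
rewrite big_seq_cond big1 ?(fsfun_dflt px) // => k' /andP[k's /eqP k'p].
by rewrite -k'p k's in px.
Qed.

(** * Element patches and the inverse of their matrix *)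

(** Corner offsets as a concrete list, so that sums over a patch unfold by computation, whatever the
    enumeration of the patch. *)
Definition cell : seq (int * int) := [:: 0; (1, 0); (0, 1); (1, 1)].

Lemma mem_element_patch (x p : int * int) :
  (p \in element_patch x) = (p - x \in cell).
Proof.
by rewrite !inE !subr_eq add0r !(addrC x) -!orbA.
Qed.

Lemma sum_element_patch (V : nmodType) (x : int * int) (F : int * int -> V) :
  \sum_(p <- element_patch x) F p = \sum_(d <- cell) F (x + d).
Proof.
rewrite -(big_map (fun d => x + d) xpredT); apply: perm_big.
apply: uniq_perm; rewrite ?fset_uniq ?(map_inj_uniq (addrI x)) // => p.
rewrite mem_element_patch; apply/idP/mapP => [px|[d dc ->]].
  by exists (p - x) => //; rewrite addrC subrK.
by rewrite [x + d]addrC addrK.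
Qed.

(** Makes the infinite sum over patches finite: the cells having [x] as a corner are those based at
    [x - d], with [d] in [cell]. *)
Lemma sum_patches_containing (V : nmodType) (x : int * int) (F : int * int -> V) :
  (forall i, x \notin element_patch i -> F i = 0) ->
  \sum_(i \in [set: int * int]) F i = \sum_(d <- cell) F (x - d).
Proof.
move=> F0; rewrite (@fsbigE _ _ _ _ _ [seq x - d | d <- cell]) ?big_map //.
  by apply: eq_bigl => d; rewrite in_setT.
  by rewrite map_inj_uniq // => d e /addrI /oppr_inj.
move=> i _ ix; apply: F0; apply: contra ix; rewrite mem_element_patch => ix.
by apply/mapP; exists (x - i); rewrite // opprB addrC subrK.
Qed.

Lemma card_element_patch (p : int * int) :
  #|` fset_set [set i | p \in element_patch i]| = 4%N.
Proof.
have -> : [set i | p \in element_patch i] =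
    [set` [fset p - d | d in cell]%fset].
  apply/seteqP; split => i /=; rewrite mem_element_patch.
    by move=> pi; apply/imfsetP; exists (p - i); rewrite // opprB addrC subrK.
  by move=> /imfsetP[d /= dc ->]; rewrite opprB addrC subrK.
rewrite set_fsetK card_imfset //=.
by move=> d e /addrI /oppr_inj.
Qed.

(* The entries of the inverse of the 4 x 4 patch matrix are h^2/24 times 7 on the
   diagonal, 2 for adjacent corners and 1 for opposite ones; k is the offset
   between the two corners. *)
Definition cell_inv {R : realType} (h : R) (k : int * int) : R[i] :=
  (h ^+ 2 / 24 * (if k == 0 then 7 else
                  if (k.1 == 0) || (k.2 == 0) then 2 else 1))%:C.

Lemma laplace_stencilE (R : realType) (h : R) (k : int * int) :
  laplace_stencil h k =
  if k == 0 then (4 / h ^+ 2)%:C else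
  if k \in [:: (1, 0); (-1, 0); (0, 1); (0, -1)] then (- 1 / h ^+ 2)%:C else 0.
Proof.
rewrite /laplace_stencil fsfun_fun !inE.
by case: (k == 0) => //=; rewrite -!orbA.
Qed.

Lemma patch_matrix_inv (R : realType) (h : R) (x : int * int) : h != 0 ->
  invmx (patch_matrix (laplace h) (element_patch x)) =
  \matrix_(j, k) cell_inv h (fsval (enum_val k) - fsval (enum_val j)).
Proof.
move=> h0.
set N := \matrix_(j, k) _.
suff AN : patch_matrix (laplace h) (element_patch x) *m N = 1%:M.
  have [uA _] := mulmx1_unit AN.
  by rewrite -[LHS]mulmx1 -AN mulKmx.
apply/matrixP => j l; rewrite !mxE.
under eq_bigr => k _ do rewrite /laplace !mxE /laplace stencil_op_delta.
rewrite (sum_patch_enum _ _ (fun p => laplace_stencil h (p - fsval (enum_val j)) *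
   cell_inv h (fsval (enum_val l) - p))).
rewrite sum_element_patch.
have -> : (j == l) = (fsval (enum_val j) - x == fsval (enum_val l) - x).
  by rewrite (inj_eq (addIr _)) (inj_eq val_inj) (inj_eq enum_val_inj).
have := valP (enum_val j); have := valP (enum_val l).
rewrite !mem_element_patch /=.
set a := _ - x; set b := _ - x.
have e1 d : x + d - fsval (enum_val j) = d - b by rewrite /b opprB addrA [d + x]addrC.
have e2 d : fsval (enum_val l) - (x + d) = a - d by rewrite opprD addrA.
under eq_bigr => d _ do rewrite e1 e2.
move: a b {e1 e2}.
(* All entries depend only on offsets from the base corner [x], so the order of the corners is
   irrelevant and sixteen scalar identities remain. *)
suff /allP H : all (fun a => all (fun b =>
    \sum_(d <- cell) laplace_stencil h (d - b) * cell_inv h (a - d) == (b == a)%:R) cell) cell.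
  by move=> a b aD bD; apply/eqP; have /allP := H _ aD; apply.
rewrite /= !andbT unlock /= !laplace_stencilE /cell_inv /=.
rewrite !mul0r !add0r !addr0 -!rmorphM -!rmorphD.
by do ?[apply/andP; split]; apply/eqP => //=; field.
Qed.


(** * Both operators as explicit finite sums of shifts *)

Lemma element_vankaE (R : realType) (h : R) (u : gridfun R) (x : int * int) :
  h != 0 ->
  element_vanka h u x =
  4^-1 * \sum_(d <- cell) \sum_(e <- cell) cell_inv h (e - d) * u (x + (e - d)).
Proof.
move=> h0; rewrite /element_vanka /vanka.
(* Contribution of patch [i] at its corner [p]; the factor [4^-1] is the weight, each point lying in
   four cells. *)
pose F i p := 4^-1 * \sum_(q <- element_patch i) cell_inv h (q - p) * u q.
have E i : patch_weight R element_patch i *m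
      invmx (patch_matrix (laplace h) (element_patch i)) *m
      patch_restrict (element_patch i) u =
    \col_j F i (fsval (enum_val j)).
  apply/matrixP => j k; rewrite patch_matrix_inv // /patch_weight -mulmxA.
  rewrite mul_diag_mx !mxE card_element_patch /F -sum_patch_enum.
  by congr (_ * _); apply: eq_bigr => l _; rewrite !mxE.
under eq_fsbigr => i _ do rewrite E patch_extend_fun.
rewrite (sum_patches_containing _ x); last by move=> i /negPf ->.
rewrite mulr_sumr big_seq [RHS]big_seq; apply: eq_bigr => d dc.
rewrite mem_element_patch opprB addrC subrK dc /F sum_element_patch.
congr (_ * _); apply: eq_bigr => e _.
have -> : x - d + e = x + (e - d) by rewrite -addrA [- d + e]addrC.
by rewrite [x + _ - x]addrC addKr.
Qed.

Lemma laplaceE (R : realType) (h : R) (u : gridfun R) (x : int * int) :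
  laplace h u x = (h ^- 2)%:C *
   (4 * u x - u (x + (1, 0)) - u (x + (-1, 0)) - u (x + (0, 1)) - u (x + (0, -1))).
Proof.
rewrite /laplace /stencil_op.
pose S := [:: 0; (1, 0); (-1, 0); (0, 1); (0, -1)] : seq (int * int).
(* Only an inclusion holds in general: for [h = 0] division by zero gives 0 and the support is
   empty. *)
have fS : {subset finsupp (laplace_stencil h) <= S}.
  move=> k; apply: contraTT; rewrite memNfinsupp laplace_stencilE.
  by rewrite !inE; case: (k == 0) => //= /negPf ->.
transitivity (\sum_(k <- S) laplace_stencil h k * u (x + k)).
  rewrite [RHS](bigID (mem (finsupp (laplace_stencil h)))) /= [X in _ + X]big1 ?addr0.
    rewrite -[RHS]big_filter; apply: perm_big; apply: uniq_perm => [||k].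
    - exact: fset_uniq.
    - exact: filter_uniq.
    - by rewrite mem_filter andb_idr // => /fS.
  by move=> k /(fsfun_dflt) ->; rewrite mul0r.
rewrite unlock /= !laplace_stencilE /=.
rewrite mulNr !rmorphM !rmorphN /= mul1r (_ : 4%:C = 4) ?rmorph_nat // !addr0.
ring.
Qed.

(** * Fourier modes and the symbols *)

Lemma fourier_modeE (R : realType) (h : R) (theta : R * R) (k : int * int) :
  h != 0 ->
  fourier_mode h theta k =
  let t := theta.1 * k.1%:~R + theta.2 * k.2%:~R in cos t +i* sin t.
Proof.
move=> h0; rewrite /fourier_mode /=.
have -> : (theta.1 * (h * k.1%:~R) + theta.2 * (h * k.2%:~R)) / h =
  theta.1 * k.1%:~R + theta.2 * k.2%:~R by field.
by [].
Qed.

(** Modes are characters of the grid, so a shift multiplies a mode by a scalar. *)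
Lemma fourier_modeD (R : realType) (h : R) (theta : R * R) (k l : int * int) :
  h != 0 ->
  fourier_mode h theta (k + l) = fourier_mode h theta k * fourier_mode h theta l.
Proof.
move=> h0; rewrite !fourier_modeE //=.
set t := _ + _; set u := _ + _; set v := _ + _.
have -> : t = u + v by rewrite /t !rmorphD /= /u /v; ring.
rewrite (cosD u v) (sinD u v).
by apply/eqP; rewrite eq_complex /=; apply/andP; split; apply/eqP; ring.
Qed.

Lemma fourier_mode_neq0 (R : realType) (h : R) (theta : R * R) (k : int * int) :
  fourier_mode h theta k != 0.
Proof.
rewrite /fourier_mode; set t := _ / h; apply/eqP => -[c0 s0].
by have := cos2Dsin2 t; rewrite c0 s0 expr0n addr0 => /eqP; rewrite eq_sym oner_eq0.
Qed.

Lemma fourier_mode0 (R : realType) (h : R) (theta : R * R) :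
  fourier_mode h theta 0 = 1.
Proof.
by rewrite /fourier_mode /= !mulr0 addr0 mul0r cos0 sin0.
Qed.

Lemma fourier_modeN (R : realType) (h : R) (theta : R * R) (k : int * int) :
  h != 0 -> fourier_mode h theta (- k) = (fourier_mode h theta k)^-1.
Proof.
move=> h0; apply: (mulfI (fourier_mode_neq0 _ h theta k)).
by rewrite -fourier_modeD // subrr fourier_mode0 divff // fourier_mode_neq0.
Qed.

Lemma fourier_modeDV (R : realType) (h : R) (theta : R * R) (k : int * int) :
  h != 0 ->
  fourier_mode h theta k + (fourier_mode h theta k)^-1 =
  (2 * cos (theta.1 * k.1%:~R + theta.2 * k.2%:~R))%:C.
Proof.
move=> h0; rewrite -fourier_modeN // !fourier_modeE //=.
rewrite !rmorphN /= !mulrN -opprD cosN sinN.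
by apply/eqP; rewrite eq_complex /=; apply/andP; split; apply/eqP; ring.
Qed.

Lemma symbolE (R : realType) (h : R) (S : gridfun R -> gridfun R)
    (theta : R * R) (z : R[i]) :
  is_symbol_at h S theta z -> symbol h S theta = z.
Proof.
move=> Sz; rewrite /symbol; case: xgetP => [w -> Sw|/(_ z)] //.
by apply: (mulIf (fourier_mode_neq0 _ h theta 0)); rewrite -Sw -Sz.
Qed.

Lemma laplace_symbol (R : realType) (h : R) (theta : R * R) : h != 0 ->
  is_symbol_at h (laplace h) theta
    ((4 - 2 * cos theta.1 - 2 * cos theta.2) / h ^+ 2)%:C.
Proof.
move=> h0 x; rewrite laplaceE.
have e1 : (-1, 0) = - (1, 0) :> (int * int) by [].
have e2 : (0, -1) = - (0, 1) :> (int * int) by [].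
rewrite e1 e2 !fourier_modeD // !fourier_modeN //.
have := fourier_modeDV _ h theta (1, 0) h0.
have := fourier_modeDV _ h theta (0, 1) h0.
rewrite /= !mulr0 !mulr1 addr0 add0r.
set a := fourier_mode h theta (1, 0); set b := fourier_mode h theta (0, 1).
move=> eb ea.
rewrite rmorphM /= !rmorphB /= -ea -eb rmorph_nat.
by rewrite (_ : (h ^- 2)%:C = (h ^+ 2)^-1%:C) //; ring.
Qed.

(** Among the sixteen differences [e - d], zero occurs four times, each unit step along an axis
    twice and each diagonal step once. Opposite shifts pair into cosines, and the diagonal ones into
    a product of cosines. *)
Lemma element_vanka_symbol (R : realType) (h : R) (theta : R * R) : h != 0 ->
  is_symbol_at h (element_vanka h) theta
    (h ^+ 2 / 24 * (7 + 2 * (cos theta.1 + cos theta.2)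
                     + cos theta.1 * cos theta.2))%:C.
Proof.
move=> h0 x; rewrite element_vankaE //.
under eq_bigr => d _ do under eq_bigr => e _ do
  rewrite fourier_modeD // mulrCA fourier_modeD // fourier_modeN //.
under eq_bigr => d _ do rewrite -mulr_sumr.
rewrite -mulr_sumr mulrCA mulrC; congr (_ * _).
have := fourier_modeDV _ h theta (1, 0) h0.
have := fourier_modeDV _ h theta (0, 1) h0.
have e11 : (1, 1) = (1, 0) + (0, 1) :> (int * int) by [].
rewrite /cell !big_cons !big_nil fourier_mode0 e11 !fourier_modeD // /cell_inv /=.
have := fourier_mode_neq0 _ h theta (1, 0).
have := fourier_mode_neq0 _ h theta (0, 1).
rewrite /= !mulr0 !mulr1 addr0 add0r.
set a := fourier_mode h theta (1, 0); set b := fourier_mode h theta (0, 1).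
rewrite !(rmorphM, rmorphD) /=.
rewrite fmorphV rmorph_nat !rmorph1 => b0 a0 eb ea.
(* With the cosines written through [a] and [b], the claim is a rational identity in these nonzero
   numbers. *)
have ->: (cos theta.1)%:C = (a + a^-1) / 2 by rewrite ea; field.
have ->: (cos theta.2)%:C = (b + b^-1) / 2 by rewrite eb; field.
by field; rewrite b0.
Qed.

Lemma element_relax_symbol (R : realType) (h omega : R) (theta : R * R) :
  h != 0 ->
  is_symbol_at h (element_relax h omega) theta
    (1 - omega%:C * symbol h (element_vanka h) theta * symbol h (laplace h) theta).
Proof.
move=> h0 x; rewrite (symbolE _ _ _ _ _ (laplace_symbol _ h theta h0)).
rewrite (symbolE _ _ _ _ _ (element_vanka_symbol _ h theta h0)) /element_relax.
have /funext -> := laplace_symbol _ h theta h0.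
set z := (_ / h ^+ 2)%:C.
(* The Laplacian returns a multiple of the mode, so homogeneity of the Vanka operator makes the
   symbols multiply. *)
have -> : element_vanka h (fun k => z * fourier_mode h theta k) x =
    z * element_vanka h (fourier_mode h theta) x.
  rewrite !element_vankaE // mulrCA; congr (_ * _).
  rewrite mulr_sumr; apply: eq_bigr => d _; rewrite mulr_sumr.
  by apply: eq_bigr => e _; rewrite mulrCA.
rewrite element_vanka_symbol //.
by ring.
Qed.

(** * Range of the symbol product over the high frequencies *)

Lemma normc_real (R : rcfType) (r : R) : Normc.normc r%:C = `|r|.
Proof. by rewrite /Normc.normc /= expr0n addr0 sqrtr_sqr. Qed.

(* The product (2 - x - y) (7 + 2 (x + y) + x y) is concave in y, so its minimum
   is on y = 1 or y = -1; with x + y = 2 t fixed it is at most its value at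
   x = y = t, which is 2 (8 - (1 + t)^3). *)
Lemma reduced_symbol_bounds (R : realType) (x y : R) :
  -1 <= x <= 0 -> -1 <= y <= 1 ->
  3 / 4 <= (2 - x - y) * (7 + 2 * (x + y) + x * y) / 12 <= 4 / 3.
Proof.
move=> /andP[x1 x0] /andP[y1 y2].
have x2 : 0 <= 2 + x by lra.
have lo : 9 <= (2 - x - y) * (7 + 2 * (x + y) + x * y).
  (* Interpolation in [y] between -1 and 1: the product minus 9 equals [3/2 p1 + 1/2 p2 + p3], where
     [p3] carries the concavity. *)
  have p1 : 0 <= (1 + y) * (- x * (2 + x)) by rewrite !mulr_ge0 //; lra.
  have p2 : 0 <= (1 - y) * (6 - x * (2 + x)) by rewrite mulr_ge0 //; [lra|nra].
  have p3 : 0 <= (2 + x) * ((1 + y) * (1 - y)) by rewrite !mulr_ge0 //; lra.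
  by lra.
have hi : (2 - x - y) * (7 + 2 * (x + y) + x * y) <= 16.
  (* Here 16 minus the product equals [(p1 + p2) / 4]. *)
  have p1 : 0 <= (2 - x - y) * (x - y) ^+ 2 by rewrite mulr_ge0 ?sqr_ge0 //; lra.
  have p2 : 0 <= (2 + x + y) ^+ 3 by rewrite exprn_ge0 //; lra.
  by lra.
by apply/andP; split; lra.
Qed.

Lemma cos_le0 (R : realType) (t : R) : pi / 2 <= t <= 3 * pi / 2 -> cos t <= 0.
Proof.
move=> /andP[t1 t2]; rewrite -[t](subrK pi) cosDpi oppr_le0.
by apply: cos_ge0_pihalf; apply/andP; split; lra.
Qed.

Lemma Thigh_cos (R : realType) (theta : R * R) : Thigh R theta ->
  cos theta.1 <= 0 \/ cos theta.2 <= 0.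
Proof.
case: theta => t1 t2 [[/= ]]; rewrite !in_itv /= => /andP[a1 b1] /andP[a2 b2].
move=> /not_andP[] /= /negP; rewrite ?a1 ?a2 /= -leNgt => c.
  by left; apply: cos_le0; rewrite c ltW.
by right; apply: cos_le0; rewrite c ltW.
Qed.

Definition reduced_symbol {R : realType} (theta : R * R) : R :=
  (2 - cos theta.1 - cos theta.2) *
  (7 + 2 * (cos theta.1 + cos theta.2) + cos theta.1 * cos theta.2) / 12.

Lemma reduced_symbol_Thigh (R : realType) (theta : R * R) : Thigh R theta ->
  3 / 4 <= reduced_symbol theta <= 4 / 3.
Proof.
have cosI (t : R) : -1 <= cos t <= 1 by rewrite cos_geN1 cos_le1.
move=> /Thigh_cos[] c0; rewrite /reduced_symbol.
  by apply: reduced_symbol_bounds => //; rewrite c0 cos_geN1.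
(* The product is symmetric in the two cosines, so their roles are exchanged. *)
have := reduced_symbol_bounds R (cos theta.2) (cos theta.1).
rewrite c0 cos_geN1 => /(_ isT (cosI _)).
by rewrite [2 - _ - _]addrAC [cos theta.2 + _]addrC [cos theta.2 * _]mulrC.
Qed.

Lemma reduced_symbol_extrema (R : realType) :
  (exists2 theta, Thigh R theta & reduced_symbol theta = 3 / 4) /\
  (exists2 theta, Thigh R theta & reduced_symbol theta = 4 / 3).
Proof.
have p0 := pi_gt0 R.
(* The low-frequency square is open at [pi / 2], so [(0, pi / 2)] counts as a high frequency and the
   lower bound is attained. *)
split; [exists (0, pi / 2) | exists (pi, pi)].
- split=> /=; first by split; rewrite /= in_itv /=; apply/andP; split; lra.
  by case=> _; rewrite in_itv /= ltxx andbF.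
- by rewrite /reduced_symbol /= cos0 cos_pihalf; lra.
- split=> /=; first by split; rewrite /= in_itv /=; apply/andP; split; lra.
  by case=> _; rewrite in_itv /= => /andP[_]; apply/negP; rewrite -leNgt; lra.
- by rewrite /reduced_symbol /= cospi; lra.
Qed.

(** * Optimization over the relaxation parameter *)

Definition max_amplification {R : realType} (omega : R) : R :=
  Num.max `|1 - omega * (3 / 4)| `|1 - omega * (4 / 3)|.

Lemma max_amplificationP (R : realType) (omega : R) :
  is_maximum [set `|1 - omega * reduced_symbol theta| | theta in Thigh R]
    (max_amplification omega).
Proof.
have [[t Ht et] [t' Ht' et']] := reduced_symbol_extrema R.
rewrite /max_amplification; split.
  rewrite /Num.max; case: ifP => _.
    by exists t'; rewrite ?et'.
  by exists t; rewrite ?et.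
move=> _ [s /reduced_symbol_Thigh /andP[s1 s2] <-].
rewrite le_max !ler_norml.
have l1 := ler_norm (1 - omega * (3 / 4)).
have l2 := ler_norm (1 - omega * (4 / 3)).
have l3 := ler_norm (- (1 - omega * (3 / 4))).
have l4 := ler_norm (- (1 - omega * (4 / 3))).
rewrite !normrN in l3 l4.
set A := `|_| in l1 l3 *; set B := `|_| in l2 l4 *.
set f := reduced_symbol s in s1 s2 *.
(* The sign of [omega] decides which end of the range bounds the affine expression from above and
   which from below. *)
have [AB|BA] := leP A B; apply/orP; [right|left]; apply/andP; split;
  have [w|w] := leP 0 omega; nra.
Qed.

(** The upper bound on [1 - 3 omega / 4] forces [omega >= 24/25], and the lower bound on
    [1 - 4 omega / 3] forces [omega <= 24/25]. This yields both minimality and uniqueness. *)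
Lemma max_amplification_le (R : realType) (omega : R) :
  (max_amplification omega <= 7 / 25) = (omega == 24 / 25).
Proof.
rewrite /max_amplification ge_max !ler_norml; apply/idP/eqP => [|->].
  by move=> /andP[/andP[a b] /andP[c d]]; lra.
by apply/andP; split; apply/andP; split; lra.
Qed.

Lemma max_amplification_opt (R : realType) : max_amplification (24 / 25 : R) = 7 / 25.
Proof.
apply/eqP; rewrite eq_le max_amplification_le eqxx /= le_max; apply/orP; left.
by rewrite ler_normr; apply/orP; left; lra.
Qed.

Lemma normc_symbols (R : realType) (h omega : R) (theta : R * R) : h != 0 ->
  Normc.normc (1 - omega%:C * symbol h (element_vanka h) theta
                 * symbol h (laplace h) theta) =
  `|1 - omega * reduced_symbol theta|.
Proof.
move=> h0; rewrite (symbolE _ _ _ _ _ (laplace_symbol _ h theta h0)).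
rewrite (symbolE _ _ _ _ _ (element_vanka_symbol _ h theta h0)).
rewrite -!rmorphM -(rmorph1 (real_complex R)) -rmorphB normc_real.
by congr `|1 - _|; rewrite /reduced_symbol; field.
Qed.

Theorem theorem3p3 (R : realType) (h : R) (h_gt0 : 0 < h) :
  exists mu : R -> R,
    [/\ forall omega : R, is_smoothing_factor h (element_relax h omega) (mu omega),
        forall omega : R,
          is_maximum
            [set Normc.normc (1 - omega%:C * symbol h (element_vanka h) theta
                                           * symbol h (laplace h) theta)
               | theta in Thigh R]
            (mu omega),
        is_minimum (range mu) (7 / 25)
      & forall omega : R, mu omega = 7 / 25 <-> omega = 24 / 25].
Proof.
have h0 : h != 0 by rewrite gt_eqF.
have maxP omega : is_maximum
    [set Normc.normc (1 - omega%:C * symbol h (element_vanka h) theta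
                                   * symbol h (laplace h) theta)
       | theta in Thigh R] (max_amplification omega).
  under eq_imagel => theta _ do rewrite normc_symbols //.
  exact: max_amplificationP.
exists max_amplification; split => //.
- move=> omega; rewrite /is_smoothing_factor.
  under eq_imagel => theta _ do
    rewrite (symbolE _ _ _ _ _ (element_relax_symbol _ h omega theta h0)).
  exact: maxP.
- split; first by exists (24 / 25); rewrite ?max_amplification_opt.
  (* A value below 7/25 would force [omega = 24/25], where the value is exactly 7/25. *)
  move=> _ [omega _ <-]; rewrite leNgt; apply/negP => lt_opt.
  have := ltW lt_opt; rewrite max_amplification_le => /eqP omega_opt.
  by rewrite omega_opt max_amplification_opt ltxx in lt_opt.
- move=> omega; split=> [e|->]; last exact: max_amplification_opt.
  by apply/eqP; rewrite -max_amplification_le e.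
Qed.
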